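(* Let $G$ be a connected $r$-regular graph with $r\geq 2$, of order $n>2$ and with $m$ edges. If all eigenvalues of the adjacency matrix $A(G)$ are integers, then the $\mathcal{Q}$-graph $\mathcal{Q}(G)$ admits no perfect state transfer, i.e. there are no two distinct vertices $x,y$ of $\mathcal{Q}(G)$ and no time $t\in\mathbb{R}$ such that $\exp(-itA(\mathcal{Q}(G)))e_x=\gamma e_y$ for some $\gamma\in\mathbb{C}$ with $|\gamma|=1$.
   Context: All graphs are finite, simple, undirected. The $\mathcal{Q}$-graph $\mathcal{Q}(G)$ of $G$ has vertex set $V(G)\cup N(G)$, where $N(G)$ contains one new vertex for each edge of $G$; each new vertex is adjacent to the two endpoints of its edge, two new vertices are adjacent iff their edges share an endpoint in $G$, and two vertices of $V(G)$ are not adjacent in $\mathcal{Q}(G)$. For a graph $H$ with adjacency matrix $A(H)$, $e_x$ denotes the characteristic (standard basis) vector of vertex $x$, and $H$ has perfect state transfer (PST) between distinct vertices $x,y$ at time $t$ if $\exp(-itA(H))e_x=\gamma e_y$ with $|\gamma|=1$. *)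

(* Defs.v *)
From mathcomp Require Import all_boot all_order all_algebra.
From mathcomp Require Import complex.
From mathcomp Require Import all_classical all_reals all_analysis.
Import Order.TTheory GRing.Theory Num.Theory.
Import numFieldNormedType.Exports.

Set Implicit Arguments.
Unset Strict Implicit.
Unset Printing Implicit Defensive.

Local Open Scope ring_scope.

Record sgraph := SGraph {
  vertex :> finType;
  adj : rel vertex;
  adj_sym : symmetric adj;
  adj_irr : irreflexive adj }.

Definition connected_graph (G : sgraph) : Prop :=
  forall x y : G, connect (@adj G) x y.

Definition regular_graph (G : sgraph) (r : nat) : Prop :=
  forall x : G, #|[set y | adj x y]| = r.

Section QGraph.
Variable G : sgraph.

Definition edges : {set {set G}} :=
  [set E : {set G} | [exists x, exists y, adj x y && (E == [set x; y])]].

Definition Qvertex : finType := (G + {E : {set G} | E \in edges})%type.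

Definition Qadj (u v : Qvertex) : bool :=
  match u, v with
  | inl _, inl _ => false
  | inl x, inr E => x \in val E
  | inr E, inl x => x \in val E
  | inr E, inr F => (E != F) && [exists x, (x \in val E) && (x \in val F)]
  end.

Lemma Qadj_sym : symmetric Qadj.
Proof.
move=> [x|E] [y|F] //=; rewrite eq_sym; congr (_ && _).
by apply: eq_existsb => x; rewrite andbC.
Qed.

Lemma Qadj_irr : irreflexive Qadj.
Proof. by move=> [x|E] //=; rewrite eqxx. Qed.

Definition Qgraph : sgraph := SGraph Qadj_sym Qadj_irr.

End QGraph.

(* Vertices index rows and columns through the enumeration of the finType. *)
Definition adjmx (K : nzRingType) (G : sgraph) : 'M[K]_#|G| :=
  \matrix_(i, j) (adj (enum_val i) (enum_val j))%:R.

Definition vertex_vec (K : nzRingType) (G : sgraph) (x : G) : 'cV[K]_#|G| :=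
  delta_mx (enum_rank x) 0.

(* [K] is an abstract [numFieldType] because [R[i]] gets its topology only
   through that structure. *)
Definition expmx (K : numFieldType) (n : nat) (M : 'M[K]_n) : 'M[K]_n :=
  limn (series (fun k : nat => (k`!%:R : K)^-1 *: M ^+ k)).

Definition pst_at (R : realType) (H : sgraph) (x y : H) (t : R) : Prop :=
  exists2 gamma : R[i], `|gamma| = 1 :> R[i] &
    expmx ((0 -i* t)%C *: adjmx R[i] H) *m vertex_vec R[i] x
      = gamma *: vertex_vec R[i] y.

Definition has_pst (R : realType) (H : sgraph) : Prop :=
  exists (x y : H) (t : R), x != y /\ pst_at x y t.

(* Main.v *)
(* Perfect state transfer from x to y at time t makes x periodic at time 2t, so
   t (a - b) is an integer multiple of pi for any two eigenvalues a, b of Q(G)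
   having an eigenvector that does not vanish at x. An eigenvector v of A(G)
   with eigenvalue b, s = b + r, lifts to the eigenvectors (s v, l B^T v) of
   Q(G), where B is the incidence matrix and l is a root of l^2 = (s - 2) l + s.
   Two values of b are used: b = r (constant v) gives roots differing by
   2 sqrt (r^2 + 1); and some b <> r, -r is visible from x, since otherwise
   A^2 - r^2 would kill the indicator vector of x (or of the ends of the edge
   x), which counting walks of length two excludes when r >= 2. The
   sums of the two roots for r and for b differ by the integer r - b, hence
   t <> 0 would make sqrt (r^2 + 1) rational. *)
Require Import Defs.
From mathcomp Require Import all_boot all_order all_algebra.
From mathcomp Require Import complex.
From mathcomp Require Import all_classical all_reals all_analysis.
From mathcomp Require Import spectral zify ring lra.
Import Order.TTheory GRing.Theory Num.Theory.
Import numFieldNormedType.Exports.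

Set Implicit Arguments.
Unset Strict Implicit.
Unset Printing Implicit Defensive.

Local Open Scope ring_scope.

(** * Eigenvectors of the Q-graph *)

Lemma eigenrowP (K : nzRingType) (H : sgraph) (a : K) (w : 'rV[K]_#|H|) :
  w *m adjmx K H = a *: w <->
  forall u : H, \sum_(x | adj x u) w 0 (enum_rank x) = a * w 0 (enum_rank u).
Proof.
have entry u : (w *m adjmx K H) 0 (enum_rank u)
    = \sum_(x | adj x u) w 0 (enum_rank x).
  rewrite mxE (reindex (@enum_rank H)) /=; last first.
    by apply: onW_bij; exact: enum_rank_bij.
  rewrite [RHS]big_mkcond; apply: eq_bigr => x _.
  by rewrite mxE !enum_rankK; case: adj; rewrite ?mulr1 ?mulr0.
split=> [wa u|wa]; first by rewrite -entry wa mxE.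
by apply/rowP => i; rewrite -(enum_valK i) entry wa mxE.
Qed.

Lemma edgesP (G : sgraph) (E : {set G}) :
  reflect (exists x y, adj x y /\ E = [set x; y]) (E \in edges G).
Proof.
rewrite finset.inE.
apply: (iffP existsP) => [[x /existsP[y /andP[xy /eqP ->]]]|[x [y [xy ->]]]].
  by exists x, y.
by exists x; apply/existsP; exists y; rewrite xy eqxx.
Qed.

Lemma edge_eq (G : sgraph) (F : {set G}) (a b : G) :
  F \in edges G -> a != b -> a \in F -> b \in F -> F = [set a; b].
Proof.
move=> /edgesP[x [y [_ ->]]] ab aF bF; apply/esym/eqP.
rewrite eqEcard finset.subUset !finset.sub1set aF bF /= !cards2 ab.
by case: (x != y).
Qed.

(** Sending [x] to [[set u; x]] is a bijection from the neighbours of [u] onto the edges containing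
    [u]; irreflexivity of [adj] gives injectivity. *)
Lemma sum_incident_edges (V : nmodType) (G : sgraph) (h : {set G} -> V) (u : G) :
  \sum_(E in edges G | u \in E) h E = \sum_(x | adj u x) h [set u; x].
Proof.
have -> : \sum_(x | adj u x) h [set u; x]
    = \sum_(x in [set x | adj u x]) h [set u; x].
  by apply: eq_bigl => x; rewrite finset.inE.
rewrite -[RHS](big_imset h) /=; last first.
  move=> x y; rewrite !finset.inE => ux uy exy.
  have : x \in [set u; y] by rewrite -exy !finset.inE eqxx orbT.
  by rewrite !finset.inE => /orP[/eqP xu|/eqP //]; rewrite xu adj_irr in ux.
apply: eq_bigl => E; apply/andP/imsetP => [[/edgesP[x [y [xy ->]]]]|[x]].
  rewrite !finset.inE => /orP[] /eqP ->; [exists y|exists x]; rewrite ?finset.inE //.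
    by rewrite adj_sym.
  by rewrite finset.setUC.
rewrite finset.inE => ux ->; rewrite !finset.inE eqxx; split=> //.
by apply/existsP; exists u; apply/existsP; exists x; rewrite ux eqxx.
Qed.

(* Distinct intersecting edges share exactly one endpoint. *)
Lemma sum_adjacent_edges (V : zmodType) (G : sgraph) (h : {set G} -> V) (a b : G) :
  adj a b ->
  \sum_(F in edges G | (F != [set a; b])
      && [exists x, (x \in F) && (x \in [set a; b])]) h F
    = \sum_(x | adj a x) h [set a; x] + \sum_(x | adj b x) h [set b; x]
      - h [set a; b] *+ 2.
Proof.
move=> ab; have anb : a != b by apply: contraTneq ab => ->; rewrite adj_irr.
have abE : [set a; b] \in edges G by apply/edgesP; exists a, b.
rewrite -!sum_incident_edges.
rewrite [X in _ = X + _ - _](bigD1 [set a; b]) /=; last first.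
  by rewrite abE !finset.inE eqxx.
rewrite [X in _ = _ + X - _](bigD1 [set a; b]) /=; last first.
  by rewrite abE !finset.inE eqxx orbT.
rewrite mulr2n addrACA [X in _ = X]addrC addKr.
(* An edge that avoids [a] can meet [[set a; b]] only in [b]. Conversely, an edge through [b] other
   than [[set a; b]] avoids [a], by [edge_eq]. *)
rewrite (bigID (fun F : {set G} => a \in F)) /=.
congr (_ + _); apply: eq_bigl => F; rewrite -!andbA;
  case: (boolP (F \in edges G)) => //= FE.
  case: eqVneq => //= _; rewrite ?andbF // andbT.
  case: (boolP (a \in F)) => aF; rewrite ?andbF //.
  by rewrite andbT; apply/existsP; exists a; rewrite aF !finset.inE eqxx.
case: eqVneq => [_|Fab] /=; rewrite ?andbF // andbT.
apply/andP/idP => [[/existsP[x /andP[xF]]]|bF].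
  by rewrite !finset.inE => /orP[]/eqP <- //; rewrite xF.
split; first by apply/existsP; exists b; rewrite bF !finset.inE eqxx orbT.
by apply: contra_neqN Fab => aF; exact: edge_eq.
Qed.

(** The edges at a vertex [u] contribute [l * (a + r) * f u]. At an edge [[set b; c]] the ends
    contribute [(a + r) * (f b + f c)] and the adjacent edges [l * (a + r - 2) * (f b + f c)]; the
    quadratic equation turns their sum into [l ^+ 2 * (f b + f c)]. *)
Lemma Qgraph_eigenrow (K : comNzRingType) (G : sgraph) (r : nat) (f : G -> K)
    (a l : K) :
  regular_graph G r ->
  (forall u, \sum_(x | adj x u) f x = a * f u) ->
  l ^+ 2 = (a + r%:R - 2) * l + (a + r%:R) ->
  let g (v : Qgraph G) : K := match v with
    | inl u => (a + r%:R) * f u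
    | inr E => l * \sum_(x in val E) f x end in
  (\row_i g (enum_val i)) *m adjmx K (Qgraph G) = l *: \row_i g (enum_val i).
Proof.
move=> Greg fa lE g; pose h (F : {set G}) := \sum_(x in F) f x.
have sumN u : \sum_(x | adj u x) h [set u; x] = (a + r%:R) * f u.
  have -> : \sum_(x | adj u x) h [set u; x] = \sum_(x | adj u x) (f u + f x).
    apply: eq_bigr => x ux; rewrite /h big_setU1 ?big_set1 // finset.inE.
    by apply: contraTneq ux => ->; rewrite adj_irr.
  rewrite big_split /= sumr_const.
  have -> : #|[pred x | adj u x]| = r.
    by rewrite -(Greg u); apply: eq_card => x; rewrite !finset.inE.
  rewrite mulrDl mulr_natl addrC -fa; congr (_ + _).
  by apply: eq_bigl => x; rewrite adj_sym.
apply/eigenrowP => v; rewrite mxE enum_rankK.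
under eq_bigr do rewrite mxE enum_rankK.
rewrite big_sumType /=; case: v => [u|[E EG]] /=.
  rewrite big_pred0 // add0r.
  rewrite -(big_sub_cond (edges G) (fun F => u \in F) (fun F => l * h F)).
  by rewrite -mulr_sumr sum_incident_edges sumN.
have /edgesP[b [c [bc Ebc]]] := EG.
rewrite -mulr_sumr -/(h E).
rewrite (eq_bigl (fun F =>
  (val F != E) && [exists x, (x \in val F) && (x \in E)])) //.
rewrite -(big_sub_cond (edges G)
    (fun F => (F != E) && [exists x, (x \in F) && (x \in E)])
    (fun F => l * h F)) -mulr_sumr Ebc sum_adjacent_edges //.
have hE : h [set b; c] = f b + f c.
  rewrite /h big_setU1 ?big_set1 // finset.inE.
  by apply: contraTneq bc => ->; rewrite adj_irr.
rewrite !sumN hE.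
transitivity (l ^+ 2 * (f b + f c)); last by ring.
by rewrite lE; ring.
Qed.

(** * The exponential of an adjacency matrix *)

Local Open Scope classical_set_scope.

Lemma cvg_mx (K : numFieldType) (p q : nat) (u : nat -> 'M[K]_(p, q))
    (l : 'M[K]_(p, q)) :
  (forall i j, (fun k => u k i j) @ \oo --> l i j) -> u @ \oo --> l.
Proof.
move=> ul; apply/cvg_mx_entourageP => A entA.
apply: filter_forall => i; apply: filter_forall => j.
have /cvg_app_entourageP/(_ A entA) := ul i j.
by apply: filterS => k /=; rewrite inE.
Qed.

Lemma cvg_subM (K : numFieldType) (u v : nat -> K) (a b c : K) :
  u @ \oo --> a -> v @ \oo --> b ->
  (fun k => u k - c * v k) @ \oo --> a - c * b.
Proof. by move=> ua vb; apply: cvgB => //; apply: cvgMr. Qed.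

Lemma cvg_real_complex (R : realType) (u : nat -> R) (l : R) :
  u @ \oo --> l ->
  (fun k => (u k)%:C%C : (R[i] : numFieldType)) @ \oo
    --> (l%:C%C : (R[i] : numFieldType)).
Proof.
move=> ul; apply/cvgrPdist_lt => -[e e'] /[!ltcE] /= /andP[/eqP -> e0].
move/cvgrPdist_lt : ul => /(_ e e0); apply: filterS => k.
by rewrite -rmorphB normc_def /= expr0n addr0 sqrtr_sqr ltcR.
Qed.

(** This is [exp (- i x)], written with the real cosine and sine so that their addition formulas and
    power series apply. *)
Definition phase (R : realType) (x : R) : R[i] := (cos x -i* sin x)%C.

Lemma phase0 (R : realType) : phase 0 = 1 :> R[i].
Proof. by rewrite /phase cos0 sin0 oppr0. Qed.

Lemma phaseD (R : realType) (x y : R) : phase (x + y) = phase x * phase y.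
Proof. by rewrite /phase cosD sinD; simpc; congr (_ +i* _)%C; ring. Qed.

Lemma norm_phase (R : realType) (x : R) : `|phase x| = 1 :> R[i].
Proof. by rewrite normc_def /= sqrrN cos2Dsin2 sqrtr1. Qed.

Lemma exp_term_complex (R : realType) (x : R) (k : nat) :
  (k`!%:R : R[i])^-1 * (0 -i* x)%C ^+ k = (cos_coeff x k -i* sin_coeff x k)%C.
Proof.
(* The truncated [k.-1] at [k = 0] is harmless, since the factor [(odd k)%:R] vanishes there. *)
have ->: (0 -i* x)%C ^+ k =
   (((~~ odd k)%:R * (-1) ^+ k./2 * x ^+ k)
      -i* ((odd k)%:R * (-1) ^+ k.-1./2 * x ^+ k))%C.
  elim: k => [|k IH]; first by rewrite !expr0 /= !mul1r !mul0r oppr0.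
  rewrite exprS IH exprS /=; case: k {IH} => [|k]; simpc.
    by congr (_ +i* _)%C; rewrite /= ?expr0; ring.
  rewrite /= negbK uphalf_half; case: (odd k) => /=; rewrite ?add0n ?add1n ?exprS;
    congr (_ +i* _)%C; ring.
have -> : (k`!%:R : R[i])^-1 = (k`!%:R^-1 : R)%:C%C by rewrite fmorphV rmorph_nat.
by rewrite /cos_coeff /sin_coeff /= -exprnP; simpc; congr (_ +i* _)%C; ring.
Qed.

Lemma cvg_phase (R : realType) (x : R) :
  series (fun k => (k`!%:R : R[i])^-1 * (0 -i* x)%C ^+ k) @ \oo
    --> (phase x : (R[i] : numFieldType)).
Proof.
have -> : series (fun k => (k`!%:R : R[i])^-1 * (0 -i* x)%C ^+ k) =
  (fun n => (series (cos_coeff x) n)%:C%C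
            - 'i%C * (series (sin_coeff x) n)%:C%C).
  apply/funext => n; rewrite /series /= !rmorph_sum mulr_sumr -sumrB.
  by apply: eq_bigr => k _; rewrite exp_term_complex /=; simpc.
have -> : phase x = (cos x)%:C%C - 'i%C * (sin x)%:C%C by rewrite /phase; simpc.
have cvgcos : series (cos_coeff x) @ \oo --> cos x.
  by rewrite unlock; exact: is_cvg_series_cos_coeff.
have cvgsin : series (sin_coeff x) @ \oo --> sin x.
  by rewrite unlock; exact: is_cvg_series_sin_coeff.
by apply: cvg_subM; exact: cvg_real_complex.
Qed.

Lemma expr_diagonalized (K : numFieldType) (n : nat) (P : 'M[K]_n) (d : 'rV[K]_n)
    (k : nat) :
  P \in unitmx ->
  (invmx P *m diag_mx d *m P) ^+ k
    = invmx P *m diag_mx (\row_l d 0 l ^+ k) *m P.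
Proof.
move=> uP; elim: k => [|k IH].
  rewrite expr0 (_ : (\row__ _) = const_mx 1); last first.
    by apply/rowP => l; rewrite !mxE expr0.
  by rewrite diag_const_mx mulmx1 mulVmx.
rewrite exprS IH -mulmxE -!mulmxA mulKVmx // [diag_mx d *m _]mulmxA mulmx_diag !mulmxA.
by congr (_ *m diag_mx _ *m _); apply/rowP => l; rewrite !mxE exprS.
Qed.

(** The value of [limn] is meaningful only for a convergent sequence, so convergence is proved entry
    by entry: each entry of a partial sum is a fixed linear combination of partial sums of the
    scalar exponential series. *)
Lemma expmx_diagonalized (K : numFieldType) (n : nat) (P : 'M[K]_n)
    (d e : 'rV[K]_n) :
  P \in unitmx ->
  (forall l, series (fun k => (k`!%:R : K)^-1 * d 0 l ^+ k) @ \oo --> e 0 l) ->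
  expmx (invmx P *m diag_mx d *m P) = invmx P *m diag_mx e *m P.
Proof.
move=> uP cvgd; apply: cvg_lim; first exact: norm_hausdorff.
apply: cvg_mx => i j.
pose term (v : 'rV[K]_n) l := invmx P i l * v 0 l * P l j.
have entry v : (invmx P *m diag_mx v *m P) i j = \sum_l term v l.
  by rewrite mul_mx_diag mxE; apply: eq_bigr => l _; rewrite mxE.
rewrite entry (_ : (fun k => _) = (fun N => \sum_l invmx P i l *
    series (fun k => (k`!%:R : K)^-1 * d 0 l ^+ k) N * P l j)); last first.
  apply/funext => N; rewrite /series /= summxE.
  transitivity (\sum_(0 <= k < N)
      \sum_l k`!%:R^-1 * term (\row_l d 0 l ^+ k) l).
    apply: eq_bigr => k _; rewrite -mulr_sumr -entry -expr_diagonalized //.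
    exact: mxE.
  rewrite exchange_big; apply: eq_bigr => l _; rewrite mulr_sumr mulr_suml.
  by apply: eq_bigr => k _; rewrite /term mxE; ring.
apply: cvg_big => [|l _]; first exact: add_continuous.
by apply: cvgMl; apply: cvgMr; exact: cvgd.
Qed.

Local Close Scope classical_set_scope.

(** A real symmetric matrix is hermitian, so the spectral theorem applies and its eigenvalues are
    real. This allows [d] to be a real row. *)
Lemma adjmx_diagonalizable (R : realType) (G : sgraph) :
  exists (P : 'M[R[i]]_#|G|) (d : 'rV[R]_#|G|), P \in unitmx /\
    adjmx R[i] G = invmx P *m diag_mx (map_mx (real_complex R) d) *m P.
Proof.
have hermG : adjmx R[i] G \is hermsymmx.
  apply/is_hermitianmxP; rewrite expr0 scale1r.
  by apply/matrixP => i j; rewrite !mxE rmorph_nat adj_sym.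
exists (spectralmx (adjmx R[i] G)).
exists (map_mx (@complex.Re R) (spectral_diag (adjmx R[i] G))).
split; first exact: spectral_unit.
rewrite {1}(orthomx_spectralP (hermitian_normalmx hermG)).
congr (_ *m diag_mx _ *m _); apply/rowP => l; rewrite !mxE RRe_real //.
by have /mxOverP := hermitian_spectral_diag_real hermG; apply.
Qed.

(** In the coordinates [z = w *m invmx P], the eigenvalue equation forces [z 0 l = 0] unless
    [d 0 l = a], so the exponential multiplies every nonzero coordinate by the same phase. *)
Lemma eigenrow_expmx (R : realType) (G : sgraph) (t a : R) (w : 'rV[R[i]]_#|G|) :
  w *m adjmx R[i] G = a%:C%C *: w ->
  w *m expmx ((0 -i* t)%C *: adjmx R[i] G) = phase (t * a) *: w.
Proof.
have [P [d [uP ->]]] := adjmx_diagonalizable R G => wa.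
have -> : (0 -i* t)%C *: (invmx P *m diag_mx (map_mx (real_complex R) d) *m P) =
    invmx P *m diag_mx (\row_l (0 -i* (t * d 0 l))%C) *m P.
  rewrite scalemxAl scalemxAr; congr (_ *m _ *m _); apply/matrixP => i j.
  by rewrite !mxE mulrnAr; congr (_ *+ _); simpc.
rewrite (expmx_diagonalized (e := \row_l phase (t * d 0 l))) //; last first.
  by move=> l; rewrite !mxE; exact: cvg_phase.
set z := w *m invmx P.
have wz : w = z *m P by rewrite mulmxKV.
have zd l : z 0 l * (d 0 l)%:C%C = a%:C%C * z 0 l.
  have := congr1 (fun v => (v *m invmx P) 0 l) wa.
  by rewrite !mulmxA mulmxK // -scalemxAl mul_mx_diag !mxE.
rewrite !mulmxA -/z [in RHS]wz scalemxAl; clearbody z.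
congr (_ *m P); apply/rowP => l.
rewrite mul_mx_diag !mxE; have [-> | zn0] := eqVneq (z 0 l) 0.
  by rewrite mul0r mulr0.
by move: (zd l); rewrite mulrC => /(mulIf zn0)/complexI ->; rewrite mulrC.
Qed.

(** The rows of a diagonalizing [P] are themselves eigenrows with real eigenvalues, so [P *m z = 0]
    with [P] invertible. *)
Lemma eigenrows_separate (R : realType) (G : sgraph) (z : 'cV[R[i]]_#|G|) :
  (forall (a : R) (w : 'rV[R[i]]_#|G|),
     w *m adjmx R[i] G = a%:C%C *: w -> w *m z = 0) ->
  z = 0.
Proof.
have [P [d [uP AE]]] := adjmx_diagonalizable R G => orth.
rewrite -(mulKmx uP z) (_ : P *m z = 0) ?mulmx0 //.
apply/row_matrixP => l; rewrite row_mul row0; apply: (orth (d 0 l)).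
rewrite -row_mul AE -!mulmxA mulKVmx // mul_diag_mx.
by apply/rowP => j; rewrite !mxE.
Qed.

(** * Periodicity forced by perfect state transfer *)

Lemma row_mul_vertex_vec (K : nzRingType) (H : sgraph) (w : 'rV[K]_#|H|) (x : H) :
  w *m vertex_vec K x = (w 0 (enum_rank x))%:M.
Proof.
apply/matrixP => i j; rewrite !ord1 !mxE (bigD1 (enum_rank x)) //= big1.
  by rewrite mxE !eqxx mulr1 addr0.
by move=> k /negPf kx; rewrite mxE kx mulr0.
Qed.

Definition in_support (R : realType) (H : sgraph) (x : H) (a : R) : Prop :=
  exists2 w : 'rV[R[i]]_#|H|,
    w *m adjmx R[i] H = a%:C%C *: w & w 0 (enum_rank x) != 0.

Lemma pst_eigenrow (R : realType) (H : sgraph) (x y : H) (t a : R)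
    (w : 'rV[R[i]]_#|H|) (g : R[i]) :
  expmx ((0 -i* t)%C *: adjmx R[i] H) *m vertex_vec R[i] x
    = g *: vertex_vec R[i] y ->
  w *m adjmx R[i] H = a%:C%C *: w ->
  phase (t * a) * w 0 (enum_rank x) = g * w 0 (enum_rank y).
Proof.
move=> xy wa; have := congr1 (fun v => (w *m v) 0 0) xy.
rewrite mulmxA (eigenrow_expmx _ wa) -scalemxAl -scalemxAr !row_mul_vertex_vec.
by rewrite !mxE !mulr1n.
Qed.

(* A conjugated eigenrow is again an eigenrow; comparing the two transfer
   identities eliminates the entry at [y]. *)
Lemma pst_periodic_phase (R : realType) (H : sgraph) (x y : H) (t : R) :
  pst_at x y t ->
  exists c : R[i], forall a : R, in_support x a -> phase (t * a) ^+ 2 = c.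
Proof.
move=> [g g1 xy]; exists (g ^+ 2) => a [w wa wx].
have cwa : map_mx (@Num.conj R[i]) w *m adjmx R[i] H
    = a%:C%C *: map_mx (@Num.conj R[i]) w.
  have := congr1 (map_mx (@Num.conj R[i])) wa; rewrite map_mxM map_mxZ.
  rewrite (_ : map_mx _ (adjmx _ _) = adjmx R[i] H); last first.
    by apply/matrixP => i j; rewrite !mxE rmorph_nat.
  by move=> ->; congr (_ *: _); apply/CrealP/complex_realP; exists a.
have := pst_eigenrow xy wa; have := pst_eigenrow xy cwa; rewrite !mxE.
set p := phase _; set wX := w 0 _; set wY := w 0 _ => e1 e2.
have p1 : p * p^* = 1 by rewrite -normCK norm_phase expr1n.
have gg : g * g^* = 1 by rewrite -normCK g1 expr1n.
have {}e2 : p^* * wX^* = g^* * wY^* by rewrite -!rmorphM e2.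
have cwX : wX^* != 0 by rewrite conjC_eq0.
apply: (mulIf cwX).
transitivity (p * (g * wY^*)); first by rewrite -e1; ring.
transitivity (p * g * (g * g^*) * wY^*); first by rewrite gg; ring.
transitivity (p * g * g * (g^* * wY^*)); first by ring.
by rewrite -e2; transitivity (g ^+ 2 * (p * p^*) * wX^*); [ring|rewrite p1; ring].
Qed.

(** At time zero every eigenrow would vanish on [e_x - g e_y], so this vector would be zero,
    although its entry at [x] is 1. *)
Lemma pst_time_neq0 (R : realType) (H : sgraph) (x y : H) (t : R) :
  x != y -> pst_at x y t -> t != 0.
Proof.
move=> xny [g _ xy]; apply/eqP => t0.
have /subr0_eq : vertex_vec R[i] x - g *: vertex_vec R[i] y = 0.
  apply: eigenrows_separate => a w wa.
  have := pst_eigenrow xy wa; rewrite t0 mul0r phase0 mul1r => wxy.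
  rewrite mulmxBr -scalemxAr !row_mul_vertex_vec wxy.
  by apply/matrixP => i j; rewrite !mxE mulrnAr subrr.
move/(congr1 (fun v : 'cV_#|H| => v (enum_rank x) 0)); rewrite !mxE !eqxx /=.
rewrite (inj_eq enum_rank_inj) (negPf xny) mulr0 => /eqP.
by rewrite oner_eq0.
Qed.

Lemma periodicz (U V : zmodType) (f : U -> V) (T : U) :
  periodic f T -> forall (k : int) a, f (a + T *~ k) = f a.
Proof.
move=> fT [n|n] a; first exact: periodicn.
by rewrite -(periodicn fT n.+1) NegzE mulrNz subrK.
Qed.

(** Reduce [x] modulo [2 pi] to [y] in [[0, 2 pi)]. Then [cos y = 1 - 2 sin (y / 2) ^ 2], and the
    sine is positive unless [y = 0]. *)
Lemma cos_eq1 (R : realType) (x : R) : cos x = 1 -> exists k : int, x = pi *+ 2 *~ k.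
Proof.
move=> cx; pose k := Num.floor (x / (pi *+ 2)); pose y := x - pi *+ 2 *~ k.
have p2 : 0 < pi *+ 2 :> R by rewrite pmulrn_lgt0 // pi_gt0.
have y0 : 0 <= y.
  rewrite subr_ge0 -mulrzr -ler_pdivlMl // mulrC; exact: floor_le_tmp.
have yp : y < pi *+ 2.
  rewrite ltrBlDr -mulrzr -[X in X + _]mulr1 -mulrDr -ltr_pdivrMl // mulrC.
  by rewrite addrC -[1]/(1%:~R) -intrD; exact: floorD1_gt.
have cy : cos y = 1 by rewrite -(periodicz (@cosD2pi R) k) /y subrK.
exists k; apply/eqP; rewrite -subr_eq0 -/y; apply/contraT => yn0.
have s0 : 0 < sin (y / 2).
  apply: sin_gt0_pi; apply/andP; split; last by rewrite ltr_pdivrMr // mulr_natr.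
  by rewrite divr_gt0 // lt_def yn0.
have := cosD (y / 2) (y / 2); rewrite -splitr cy -!expr2 cos2sin2.
move=> /eqP; rewrite -subr_eq0; nra.
Qed.

(** Squaring doubles the angle, so the angles are determined only modulo [pi]. *)
Lemma phase_sqr_eq (R : realType) (x y : R) :
  phase x ^+ 2 = phase y ^+ 2 -> exists k : int, x - y = pi *~ k.
Proof.
rewrite !expr2 -!phaseD => -[cxy /oppr_inj sxy].
have [k ek] : exists k : int, (x + x) - (y + y) = pi *+ 2 *~ k.
  by apply: cos_eq1; rewrite cosB cxy sxy -!expr2 cos2Dsin2.
exists k; move: ek; rewrite mulr2n mulrzDl; lra.
Qed.

Lemma pst_support_diff (R : realType) (H : sgraph) (x y : H) (t : R) :
  pst_at x y t ->
  forall a b : R, in_support x a -> in_support x b ->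
  exists k : int, t * (a - b) = pi *~ k.
Proof.
move=> /pst_periodic_phase[c pc] a b /pc ha /pc hb.
by rewrite mulrBr; apply: phase_sqr_eq; rewrite ha hb.
Qed.

(** * Eigenvalues in the support of a vertex *)

(** Otherwise every eigenrow kills [A^2 p - r^2 p], where [p] is the indicator of [S], so this
    vector is zero. Its entry at [u] compares the number of walks of length two from [u] into [S]
    with [r ^ 2], against the assumed bound. *)
Lemma exists_seen_eigenrow (R : realType) (G : sgraph) (r : nat) (S : {set G})
    (u : G) :
  u \in S ->
  (\sum_(c | adj u c) #|[set y in S | adj c y]| < r ^ 2)%N ->
  exists (a : R) (w : 'rV[R[i]]_#|G|),
    [/\ w *m adjmx R[i] G = a%:C%C *: w,
        \sum_(x in S) w 0 (enum_rank x) != 0 & a ^+ 2 != r%:R ^+ 2].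
Proof.
move=> uS small; apply: contrapT => none.
pose p : 'cV[R[i]]_#|G| := \col_i (enum_val i \in S)%:R.
have reidx (F : 'I_#|G| -> R[i]) : \sum_i F i = \sum_x F (enum_rank x).
  by apply: reindex; apply: onW_bij; exact: enum_rank_bij.
have wp w : (w *m p) = (\sum_(x in S) w 0 (enum_rank x))%:M.
  apply/matrixP => i j; rewrite !ord1 !mxE reidx [in RHS]big_mkcond mulr1n.
  apply: eq_bigr => x _; rewrite mxE enum_rankK.
  by case: (x \in S); rewrite ?mulr1 ?mulr0.
have Av (v : 'cV[R[i]]_#|G|) x :
    (adjmx R[i] G *m v) (enum_rank x) 0 = \sum_(y | adj x y) v (enum_rank y) 0.
  rewrite mxE reidx [in RHS]big_mkcond; apply: eq_bigr => y _.
  by rewrite mxE !enum_rankK; case: adj; rewrite ?mul1r ?mul0r.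
have /subr0_eq : adjmx R[i] G *m (adjmx R[i] G *m p) - (r%:R ^+ 2)%:C%C *: p = 0.
  apply: eigenrows_separate => a w wa.
  rewrite mulmxBr !mulmxA wa -scalemxAl wa scalerA -!scalemxAl -scalemxAr.
  rewrite -scalerBl -expr2 -rmorphXn -rmorphB wp.
  have [->|s0] := eqVneq (\sum_(x in S) w 0 (enum_rank x)) 0.
    by rewrite raddf0 scaler0.
  have [->|ar] := eqVneq (a ^+ 2) (r%:R ^+ 2); first by rewrite subrr scale0r.
  by case: none; exists a, w.
move/(congr1 (fun v : 'cV_#|G| => v (enum_rank u) 0)).
rewrite Av !mxE enum_rankK uS mulr1.
rewrite (_ : \sum_(y | _) _ = (\sum_(c | adj u c) #|[set y in S | adj c y]|)%:R).
  rewrite rmorphXn rmorph_nat -natrX => /eqP; rewrite eqr_nat => /eqP e.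
  by rewrite e ltnn in small.
rewrite natr_sum; apply: eq_bigr => c _; rewrite Av -sum1_card natr_sum.
rewrite [LHS]big_mkcond [RHS]big_mkcond; apply: eq_bigr => y _.
by rewrite mxE enum_rankK finset.inE; case: (y \in S); case: adj.
Qed.

(** Up to a scalar factor, the entry at [x] of an eigenrow lifted to the Q-graph is the sum of the
    original eigenrow over this set. *)
Definition Qends (G : sgraph) (x : Qgraph G) : {set G} :=
  match x with inl u => [set u]%SET | inr E => val E end.

(** For a vertex, each of the [r] neighbours leads back in at most one way, and [r < r ^ 2]. For an
    edge [[set a; b]], start at [a]: the neighbour [b] leads only to [a], and each of the other
    [r - 1] neighbours to at most two ends, giving at most [2 r - 1 < r ^ 2]. *)
Lemma Qends_two_walks (G : sgraph) (r : nat) (x : Qgraph G) :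
  regular_graph G r -> (2 <= r)%N ->
  exists2 u : G, u \in Qends x &
    (\sum_(c | adj u c) #|[set y in Qends x | adj c y]%SET| < r ^ 2)%N.
Proof.
move=> Greg r2; have degN (u : G) : #|[pred c | adj u c]| = r.
  by rewrite -(Greg u); apply: eq_card => c; rewrite !finset.inE.
case: x => [u|[E EG]] /=.
  exists u; first by rewrite finset.inE.
  apply: (@leq_ltn_trans (\sum_(c | adj u c) 1)%N).
    apply: leq_sum => c _; rewrite -(cards1 u); apply: subset_leq_card.
    by apply/fintype.subsetP => y; rewrite !finset.inE => /andP[].
  by rewrite sum1_card degN -{1}[r]expn1 ltn_exp2l.
have /edgesP[a [b [ab ->]]] := EG; exists a; first by rewrite !finset.inE eqxx.
rewrite (bigD1 b) //=; apply: (@leq_ltn_trans (1 + 2 * r.-1)%N); last by nia.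
apply: leq_add.
  rewrite -(cards1 a); apply: subset_leq_card; apply/fintype.subsetP => y.
  rewrite !finset.inE => /andP[/orP[//|/eqP ->]].
  by rewrite adj_irr.
apply: (@leq_trans (\sum_(c | adj a c && (c != b)) 2)%N).
  apply: leq_sum => c _; apply: (@leq_trans #|[set a; b]%SET|).
    apply: subset_leq_card; apply/fintype.subsetP => y.
    by rewrite !finset.inE => /andP[].
  by rewrite cards2; case: (a != b).
rewrite sum_nat_const mulnC leq_mul2l /=.
rewrite -(degN a) (cardD1 b [pred c | adj a c]) finset.inE ab /=.
by apply: subset_leq_card; apply/fintype.subsetP => y; rewrite !finset.inE andbC.
Qed.

Lemma Qgraph_support (R : realType) (G : sgraph) (r : nat) (x : Qgraph G)
    (a l : R) (w : 'rV[R[i]]_#|G|) :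
  regular_graph G r ->
  w *m adjmx R[i] G = a%:C%C *: w ->
  \sum_(u in Qends x) w 0 (enum_rank u) != 0 ->
  a + r%:R != 0 -> l ^+ 2 = (a + r%:R - 2) * l + (a + r%:R) ->
  in_support x l.
Proof.
move=> Greg /eigenrowP wa xw s0 lE.
(* A zero root would force [a + r = 0] in the quadratic equation. *)
have l0 : l != 0 by apply: contra_neq s0 => l0; move: lE; rewrite l0; lra.
have lEC : (l%:C%C : R[i]) ^+ 2 = (a%:C%C + r%:R - 2) * l%:C%C + (a%:C%C + r%:R).
  by rewrite -rmorphXn lE !(rmorphD, rmorphN, rmorphM, rmorph_nat).
have := Qgraph_eigenrow Greg wa lEC => /= H.
eexists; first exact: H.
rewrite mxE enum_rankK; case: x xw => [u|E] /=.
  rewrite big_set1 => wu; rewrite mulf_neq0 //.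
  by rewrite -(rmorph_nat (real_complex R)) -rmorphD fmorph_eq0.
by move=> wE; rewrite mulf_neq0 // fmorph_eq0.
Qed.

Lemma constant_eigenrow (K : comNzRingType) (G : sgraph) (r : nat) :
  regular_graph G r -> const_mx 1 *m adjmx K G = r%:R *: const_mx 1 :> 'rV_#|G|.
Proof.
move=> Greg; apply/eigenrowP => u; rewrite mxE mulr1 -(Greg u).
under eq_bigr do rewrite mxE.
rewrite sumr_const; congr (_%:R); apply: eq_card => x.
by rewrite !finset.inE adj_sym.
Qed.

(** * Irrationality of [sqrt (r^2 + 1)] and the final contradiction *)

(** Divisibility of squares reduces the equation to [4 r^2 + 4 = c^2], but this number lies strictly
    between [(2 r)^2] and [(2 r + 1)^2]. *)
Lemma four_sqrD4_not_square_ratio (r j k : nat) :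
  (0 < r)%N -> (0 < j)%N -> (j ^ 2 * (4 * r ^ 2 + 4))%N <> (k ^ 2)%N.
Proof.
move=> r0 j0 e; have /dvdnP[c kc] : (j %| k)%N.
  by rewrite -(@dvdn_pexp2r _ _ 2) // -e dvdn_mulr.
have c2 : (4 * r ^ 2 + 4 = c ^ 2)%N.
  by apply/eqP; rewrite -(@eqn_pmul2l (j ^ 2)) ?expn_gt0 ?j0 // e kc expnMn mulnC.
have [cr|cr] := leqP c (2 * r)%N; nia.
Qed.

(** Eliminating [t] and [pi] from the two relations gives [j q = k m] with [j] nonzero; squaring
    yields an integer equation excluded by the previous lemma. *)
Lemma incommensurable_times (R : realType) (r : nat) (q t : R) (m j k : int) :
  (0 < r)%N -> q ^+ 2 = 4 * r%:R ^+ 2 + 4 -> t != 0 -> m != 0 ->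
  t * q = pi *~ k -> t * m%:~R = pi *~ j -> False.
Proof.
move=> r0 q2 t0 m0 tq tm.
have pi0 : pi != 0 :> R by rewrite gt_eqF // pi_gt0.
have j0 : j != 0.
  apply: contra_neq (mulf_neq0 t0 (_ : m%:~R != 0 :> R)) => [j0|].
    by rewrite tm j0 mulr0z.
  by rewrite intr_eq0.
have jq : j%:~R * q = (k * m)%:~R :> R.
  apply: (mulfI (mulf_neq0 pi0 t0)); rewrite rmorphM.
  move: tq tm; rewrite -![pi *~ _]mulrzr => tq tm.
  transitivity (t * q * (pi * j%:~R)); first by ring.
  by rewrite tq -tm; ring.
have : (j ^+ 2 * (4 * r%:Z ^+ 2 + 4))%:~R = ((k * m) ^+ 2)%:~R :> R.
  rewrite [RHS]rmorphXn /= -jq exprMn q2.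
  by rewrite !(rmorphM, rmorphD, rmorphXn) /=; ring.
move/intr_inj/(congr1 absz); rewrite abszM !abszX => e.
apply: (@four_sqrD4_not_square_ratio r (absz j) (absz (k * m))) => //.
by rewrite absz_gt0.
Qed.

Theorem theorem4p2 (R : realType) (G : sgraph) (r n m : nat)
    (hconn : connected_graph G) (hreg : regular_graph G r) (hr : (2 <= r)%N)
    (hn : #|G| = n) (hn2 : (2 < n)%N) (hm : #|edges G| = m)
    (hint : forall a : R[i], eigenvalue (adjmx R[i] G) a ->
       exists z : int, a = z%:~R) :
  ~ has_pst R (Qgraph G).
Proof.
move=> [x [y [t [xy tr]]]].
have t0 := pst_time_neq0 xy tr.
have [u ux walks] := Qends_two_walks x hreg hr.
have [a [w [wa wx ar]]] := exists_seen_eigenrow R ux walks.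
have [z az] : exists z : int, a = z%:~R.
  have [|z az] := hint a%:C%C.
    apply/eigenvalueP; exists w => //; apply: contra_neq wx => ->.
    by rewrite big1 // => v _; rewrite mxE.
  by exists z; apply: (@complexI R); rewrite az rmorph_int.
have ones_x : \sum_(v in Qends x)
    (const_mx 1 : 'rV[R[i]]_#|G|) 0 (enum_rank v) != 0.
  under eq_bigr do rewrite mxE.
  by rewrite sumr_const pnatr_eq0 -lt0n; apply/card_gt0P; exists u.
have ones_eig : const_mx 1 *m adjmx R[i] G
    = (r%:R : R)%:C%C *: const_mx 1 :> 'rV_#|G|.
  by rewrite rmorph_nat; exact: constant_eigenrow.
have r0 : 0 < r%:R :> R by rewrite ltr0n; apply: leq_trans hr.
have sa0 : a + r%:R != 0.
  by apply: contra_neq ar => /eqP; rewrite addr_eq0 => /eqP ->; rewrite sqrrN.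
have sr0 : r%:R + r%:R != 0 :> R by rewrite gt_eqF // addr_gt0.
(* The two eigenvalues of the Q-graph that an eigenvalue [b] of [G] gives rise
   to, for [e = 1] and [e = -1]. *)
pose root (e b : R) := (b + r%:R - 2 + e * Num.sqrt ((b + r%:R) ^+ 2 + 4)) / 2.
have rootP (e b : R) : e ^+ 2 = 1 ->
    root e b ^+ 2 = (b + r%:R - 2) * root e b + (b + r%:R).
  move=> e1; have := @sqr_sqrtr R ((b + r%:R) ^+ 2 + 4).
  rewrite /root addr_ge0 ?sqr_ge0 //; set q := Num.sqrt _ => /(_ isT) q2.
  have : (e * q) ^+ 2 = (b + r%:R) ^+ 2 + 4 by rewrite exprMn e1 mul1r.
  by move: (e * q) => p p2; move: p2; nra.
have supp_r e (e1 : e ^+ 2 = 1) : in_support x (root e r%:R).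
  exact: (Qgraph_support hreg ones_eig ones_x sr0 (rootP _ _ e1)).
have supp_a e (e1 : e ^+ 2 = 1) : in_support x (root e a).
  exact: (Qgraph_support hreg wa wx sa0 (rootP _ _ e1)).
have e1 : 1 ^+ 2 = 1 :> R by rewrite expr1n.
have eN1 : (-1) ^+ 2 = 1 :> R by rewrite sqrrN expr1n.
have [k tq] := pst_support_diff tr (supp_r _ e1) (supp_r _ eN1).
have [j1 t1] := pst_support_diff tr (supp_r _ e1) (supp_a _ e1).
have [j2 t2] := pst_support_diff tr (supp_r _ eN1) (supp_a _ eN1).
(* This [q] is the difference of the two roots for [b = r]. Adding the relations [t1] and [t2]
   cancels all square roots: the two roots for [b] sum to [b + r - 2], which leaves
   [t * (r - a) = pi *~ (j1 + j2)]. *)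
pose q : R := Num.sqrt ((r%:R + r%:R) ^+ 2 + 4).
apply: (@incommensurable_times R r q t (r%:Z - z) (j1 + j2) k) => //.
- exact: leq_trans hr.
- by rewrite sqr_sqrtr ?addr_ge0 ?sqr_ge0 //; ring.
- by apply: contra_neq ar => /subr0_eq rz; rewrite az -rz.
- by rewrite -tq /root -/q; congr (_ * _); field.
- by rewrite [RHS]mulrzDr -t1 -t2 /root rmorphB /= -az; field.
Qed.
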